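(* Let $p$ be a prime and $k$ a positive integer. There is a $p$-tuple $\mathcal{I}=(\rho_1,\ldots,\rho_p)$ of faithful permutation representations of $G_k(p)$ in $\mathrm{Sym}(\Omega)$, each with image the permutation group $\overline{G_k(p)}$ on $\Omega$, such that the twisted permutation code $\mathrm{Tw}(G_k(p),\mathcal{I})$ has size $p^{k+1}$, length $p^{k+1}$ and minimum distance $p^{k+1}-p$, and can be decoded using an uncovering-by-bases of optimal size $r'+1=\left\lfloor\frac{p^k-1}{2}\right\rfloor$.
   Context: Let $B_k$ be the $k\times k$ lower unitriangular matrix over $\mathbb{F}_p$ with $1$'s on the main diagonal and on the first subdiagonal and $0$ elsewhere; it has multiplicative order $p$. Let $V=\mathbb{F}_p^k$ (row vectors), let $H_k(p)=\langle B_k\rangle\leq GL(k,p)$, and let $G_k(p)=V\rtimes H_k(p)\leq\mathrm{AGL}(k,p)$, a group of order $p^{k+1}$. For $\mathbf{v}\in\mathbb{F}_p^k$ and $0\leq i<p$ let $$A_{\mathbf{v},i}=\begin{bmatrix}1&\mathbf{v}\\ \mathbf{0}^T&B_k^i\end{bmatrix},$$ and let $\overline{G_k(p)}$ be the set of all such matrices. This is a subgroup of $GL(k+1,p)$ isomorphic to $G_k(p)$, and it acts faithfully and transitively by right multiplication on the set $\Omega=\{(1,\mathbf{v}):\mathbf{v}\in\mathbb{F}_p^k\}$ of $p^k$ row vectors; it is thus regarded as a subgroup of $\mathrm{Sym}(\Omega)$. A permutation $x$ of $\Omega$ in list form is the word indexed by $\Omega$ whose entry in position $\omega$ is $\omega^x$.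 For a tuple $\mathcal{I}=(\rho_1,\ldots,\rho_\lambda)$ of permutation representations of a group $G$ in $\mathrm{Sym}(\Omega)$, the twisted permutation code is $\mathrm{Tw}(G,\mathcal{I})=\{[\rho_1(g)\mid\cdots\mid\rho_\lambda(g)]:g\in G\}$ (concatenations of list forms). Its minimum distance $\delta_{\mathrm{tw}}$ is the minimum Hamming distance between distinct codewords. Put $r_{\mathrm{tw}}=\lfloor(\delta_{\mathrm{tw}}-1)/2\rfloor$ and $r'=\lfloor r_{\mathrm{tw}}/\lambda\rfloor$; here $\lambda=p$. A base for a permutation group on $\Omega$ is a subset of $\Omega$ whose pointwise stabilizer is trivial. An uncovering-by-bases of strength $r$ is a collection of bases such that every $r$-subset of $\Omega$ is disjoint from at least one base in the collection. ''Can be decoded using an uncovering-by-bases of optimal size $r'+1$'' means that there is an uncovering-by-bases $\mathcal{U}$ of strength $r'$ for $\overline{G_k(p)}$ acting on $\Omega$ with $|\mathcal{U}|=r'+1$, the smallest possible size for that strength, and that it serves for decoding as follows: for every transmitted codeword $[\rho_1(g)\mid\cdots\mid\rho_p(g)]$ and every received word $[w_1\mid\cdots\mid w_p]$ containing at most $r_{\mathrm{tw}}$ errors, some component $w_i$ has no errors in the positions in some base $B\in\mathcal{U}$, so that $\rho_i(g)$ is the unique element of $\overline{G_k(p)}$ agreeing with $w_i$ in those positions; one tries each base in each component until the resulting codeword is within distance $r_{\mathrm{tw}}$ of the received word.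
   Formalization: Stated for 1 < k < p rather than every positive integer k: for k = 1 or k > p the group does not have order p^{k+1}; for k = p ≥ 3 the minimum distance p^{k+1}-p is impossible; for k = p = 2 the formula for r'+1 fails. *)

(* Defs.v *)
From HB Require Import structures.
From mathcomp Require Import all_boot all_order all_algebra all_fingroup.

Set Implicit Arguments.
Unset Strict Implicit.
Unset Printing Implicit Defensive.

Import GRing.Theory.
Local Open Scope ring_scope.

Definition Bmx (p k : nat) : 'M['F_p]_k :=
  \matrix_(i, j) ((i == j) || (i == j.+1 :> nat))%:R.

Lemma Bmx_unit p k : Bmx p k \in unitmx.
Proof.
rewrite unitmxE det_trig.
  by rewrite big1 ?unitr1 // => i _; rewrite mxE eqxx.
apply/is_trig_mxP => i j ltij; rewrite mxE.
case: eqP ltij => [->|_]; first by rewrite ltnn.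
by case: eqP => // ->; rewrite ltnNge leqnSn.
Qed.

Definition transl (p k : nat) (v : 'rV['F_p]_k) : {perm 'rV['F_p]_k} :=
  perm (@addIr _ v).

Definition Bperm (p k : nat) : {perm 'rV['F_p]_k} :=
  perm (can_inj (mulmxK (Bmx_unit p k))).

(* V, embedded in AGL(k, p) as the group of translations of F_p^k *)
Definition translations (p k : nat) : {set {perm 'rV['F_p]_k}} :=
  [set transl v | v : 'rV['F_p]_k].

Lemma group_set_translations p k : group_set (translations p k).
Proof.
apply/group_setP; split.
  by apply/imsetP; exists 0 => //; apply/permP => x; rewrite !permE addr0.
move=> _ _ /imsetP[u _ ->] /imsetP[v _ ->]; apply/imsetP; exists (u + v) => //.
by apply/permP => x; rewrite permM !permE addrA.
Qed.
Canonical translations_group p k := Group (group_set_translations p k).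

Definition Hk (p k : nat) : {group {perm 'rV['F_p]_k}} := <[Bperm p k]>%G.

Definition Gk (p k : nat) : {group {perm 'rV['F_p]_k}} :=
  (translations p k <*> Hk p k)%G.

Lemma Gk_sdprod p k : (translations p k ><| Hk p k = Gk p k)%g.
Proof.
have nVH : Hk p k \subset ('N(translations p k))%g.
  rewrite cycle_subG inE; apply/subsetP=> _ /imsetP[_ /imsetP[v _ ->] ->].
  apply/imsetP; exists (v *m Bmx p k) => //; apply/permP => x.
  rewrite conjgE !permM [RHS]permE.
  have [y ->] : exists y, x = Bperm p k y.
    by exists ((Bperm p k)^-1%g x); rewrite permKV.
  by rewrite permK !(permE, mulmxDl).
rewrite /Gk /= norm_joinEr //; apply: sdprodE => //.
apply/trivgP/subsetP=> s /setIP[/imsetP[v _ ->] /cycleP[n sB]].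
have s0 : transl v 0 = 0.
  rewrite sB; elim: n {sB} => [|n IHn]; first by rewrite expg0 perm1.
  by rewrite expgSr permM IHn permE mul0mx.
move: s0; rewrite permE add0r => ->.
by apply/set1P/permP => x; rewrite !permE addr0.
Qed.

Definition Amx (p k : nat) (v : 'rV['F_p]_k) (i : nat) : 'M['F_p]_(1 + k) :=
  block_mx 1%:M v 0 (Bmx p k ^+ i).

Definition Gbar_mx (p k : nat) : {set 'M['F_p]_(1 + k)} :=
  [set Amx v i | v : 'rV['F_p]_k, i : 'I_p].

Record Omega (p k : nat) := MkOmega {
  omega_val :> 'rV['F_p]_(1 + k);
  _ : lsubmx omega_val == 1%:M }.

HB.instance Definition _ p k := [isSub for @omega_val p k].
HB.instance Definition _ p k := [Finite of Omega p k by <:].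

(* A plain {set}: it is a group only when B_k has order dividing p. *)
Definition Gbar (p k : nat) : {set {perm Omega p k}} :=
  [set s : {perm Omega p k} |
     [exists A in Gbar_mx p k,
        [forall w : Omega p k, val (s w) == val w *m A]]].

Local Open Scope nat_scope.

Section Codes.
Variables P A : finType.
Implicit Types (c w : {ffun P -> A}) (C : {set {ffun P -> A}}).

Definition hamming c w : nat := #|[set x | c x != w x]|.

Definition code_length C : nat := #|P|.

(* The default value #|P| of the minimum is an upper bound of [hamming], so
   it is only visible when C has fewer than two codewords. *)
Definition min_dist C : nat :=
  \big[minn/#|P|]_(cw in setX C C | cw.1 != cw.2) hamming cw.1 cw.2.

Definition corr_capacity C : nat := (min_dist C - 1)./2.

End Codes.

Section Uncovering.
Variable T : finType.
Implicit Types (K : {set {perm T}}) (B : {set T}) (U : {set {set T}}).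

Definition is_base K B : bool := 'C_K(B | 'P)%g == 1%g.

Definition is_ubb K (r : nat) U : Prop :=
  (forall B, B \in U -> is_base K B) /\
  (forall R : {set T}, #|R| = r -> exists2 B, B \in U & [disjoint R & B]).

Definition is_optimal_ubb K (r : nat) U : Prop :=
  is_ubb K r U /\ forall U', is_ubb K r U' -> #|U| <= #|U'|.

End Uncovering.

Section Twisted.
Variables (gT : finGroupType) (G : {group gT}) (T : finType) (lam : nat).
Variable rho : 'I_lam -> {morphism G >-> {perm T}}.

Definition tw_word (g : gT) : {ffun 'I_lam * T -> T} :=
  [ffun x => rho x.1 g x.2].

Definition Tw : {set {ffun 'I_lam * T -> T}} := [set tw_word g | g in G].

Definition agrees (s : {perm T}) (w : {ffun 'I_lam * T -> T})
    (i : 'I_lam) (B : {set T}) : bool :=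
  [forall x in B, s x == w (i, x)].

Fixpoint decode (r : nat) (tries : seq ('I_lam * {set T}))
    (w : {ffun 'I_lam * T -> T}) : option {ffun 'I_lam * T -> T} :=
  if tries is (i, B) :: tries' then
    if [pick g in G | agrees (rho i g) w i B] is Some g then
      if hamming (tw_word g) w <= r then Some (tw_word g)
      else decode r tries' w
    else decode r tries' w
  else None.

(* The pairs (component, base) may be tried in any order. *)
Definition ubb_decodes (K : {set {perm T}}) (r : nat) (U : {set {set T}}) :=
  forall g (w : {ffun 'I_lam * T -> T}),
    g \in G -> hamming (tw_word g) w <= r ->
    (exists i : 'I_lam, exists2 B, B \in U &
       agrees (rho i g) w i B /\
       forall s, s \in K -> agrees s w i B -> s = rho i g) /\
    (forall tries : seq ('I_lam * {set T}),
       tries =i setX [set: 'I_lam] U -> decode r tries w = Some (tw_word g)).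

End Twisted.

(* Main.v *)
Require Import Defs.
From mathcomp Require Import all_boot all_order all_algebra all_fingroup.
From mathcomp Require Import cyclic.

Set Implicit Arguments.
Unset Strict Implicit.
Unset Printing Implicit Defensive.

Import Order.TTheory GRing.Theory.

(** Two codewords of a twisted permutation code agree at position [(j, x)]
    exactly when [x] is a fixed point of [rho j (g h^-1)], so the minimum
    distance is governed by the total number of fixed points that a nontrivial
    element of the group has in the [p] representations together.

    An element of [G_k(p)] sends the vector [u] to [u B^i + a].  When it is not
    the identity it has at most [p] fixed points: the kernel of [B^i - 1], for
    [i] prime to [p], is the kernel of the shift [N = B - 1], a line
    ([Gk_card_fix]).  Since [B] preserves the last coordinate of every vector,
    a fixed point can exist only if the last coordinate of [a] vanishes.  The
    representations are chosen so that this obstruction varies: for each vector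
    [w] the map [u |-> u B + w] still has order [p], because [k < p] kills the
    sum [1 + B + ... + B^(p-1)], and so there is an automorphism of [G_k(p)]
    that fixes every translation and sends [B] to that map ([twist]).  For
    [w = c e], with [e] the last standard basis vector, it adds [i c] to the
    last coordinate of [a].  As [i] is invertible modulo [p], among the [p]
    values of [c] at most one makes that coordinate vanish
    ([twist_fix_unique]).  Hence a nontrivial element has at most [p] fixed
    points in all [p] representations together, and [B] has [p] of them, which
    gives minimum distance [p * p^k - p].

    With [p^k = 2 m + 1] the correction capacity is [p m - 1], so that
    [r' = m - 1].  Two points form a base as soon as the difference of the
    vectors is outside the line [ker N] ([Gbar_is_base]).  The cosets of that
    line have [p <= m] points, so [m] disjoint pairs with this property exist
    ([exists_pairing]).  By the pigeonhole principle [m] disjoint bases form an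
    uncovering of strength [m - 1] ([is_ubb_disjoint]), and no uncovering by
    bases of strength [r] has fewer than [r + 1] members ([ubb_card_gt]).
    Finally, at most [r_tw] errors are spread over [p] components, so that some
    component has at most [r'] of them, and these are avoided by a base, which
    determines the transmitted group element ([ubb_decodes_twisted]). *)

(** * Minimum distance and unique decoding *)

Section Codes.
Variables P A : finType.
Implicit Types (c d w : {ffun P -> A}) (C : {set {ffun P -> A}}).

Lemma hammingC c d : hamming c d = hamming d c.
Proof. by apply: eq_card => x; rewrite !inE eq_sym. Qed.

Lemma hamming_gt0 c d : c != d -> 0 < hamming c d.
Proof.
apply: contraNT; rewrite -eqn0Ngt cards_eq0 => /eqP E; apply/eqP/ffunP => x.
by apply/eqP; move/setP/(_ x): E; rewrite !inE => /negbFE.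
Qed.

Lemma hamming_triangle c w d : hamming c d <= hamming c w + hamming w d.
Proof.
apply: leq_trans (leq_card_setU _ _); apply: subset_leq_card.
apply/subsetP => x; rewrite !inE -negb_and; apply: contra.
by case/andP => /eqP-> /eqP->.
Qed.

Lemma min_dist_le_hamming C c d :
  c \in C -> d \in C -> c != d -> min_dist C <= hamming c d.
Proof.
move=> Cc Cd cd; rewrite /min_dist -minEnat -leEnat.
apply: (@bigmin_le_cond _ _ _ _ (c, d) _ (fun cw => hamming cw.1 cw.2)).
by rewrite inE Cc Cd cd.
Qed.

Lemma min_dist_le_length C : min_dist C <= #|P|.
Proof. by rewrite /min_dist -minEnat -leEnat; apply: bigmin_le_id. Qed.

Lemma le_min_dist C m : m <= #|P| ->
    (forall c d, c \in C -> d \in C -> c != d -> m <= hamming c d) ->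
  m <= min_dist C.
Proof.
move=> mP mC; apply: (big_ind (leq m)) => // [a b ma mb | [c d]].
  by rewrite leq_min ma.
by rewrite inE /= => /andP[/andP[Cc Cd] cd]; apply: mC.
Qed.

(** The triangle inequality separates the balls of this radius around distinct
    codewords. *)
Lemma corr_capacity_unique C c d w :
    c \in C -> d \in C -> hamming c w <= corr_capacity C ->
    hamming d w <= corr_capacity C ->
  c = d.
Proof.
move=> Cc Cd cw dw; apply/eqP/contraT => cd.
have le_cd : hamming c d <= (corr_capacity C).*2.
  by rewrite -addnn (leq_trans (hamming_triangle c w d)) // leq_add // hammingC.
have := leq_trans (min_dist_le_hamming Cc Cd cd) le_cd.
move: (leq_trans (hamming_gt0 cd) le_cd); rewrite /corr_capacity.
(* Minimum distance 0 would give radius 0, that is, equal codewords. *)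
case: (min_dist C) => // m _; rewrite subn1 /= leqNgt ltnS.
by rewrite -[leqRHS]odd_double_half leq_addl.
Qed.

End Codes.

(** * Uncoverings by bases *)

(** An uncovering of strength [r] speaks of sets of exactly [r] points; this
    reduces smaller sets to that size. *)
Lemma exists_superset_card (T : finType) (R : {set T}) r :
  #|R| <= r <= #|T| -> exists2 R' : {set T}, R \subset R' & #|R'| = r.
Proof.
elim: r => [|r IHr] /andP[Rr rT].
  by exists R => //; apply/eqP; rewrite -leqn0.
move: Rr; rewrite leq_eqVlt => /predU1P[<-|Rr]; first by exists R.
have [|R' sRR' R'r] := IHr; first by rewrite -ltnS Rr ltnW.
have /set0Pn[x xR'] : ~: R' != set0.
  by rewrite -card_gt0 cardsCs setCK R'r subn_gt0.
exists (x |: R'); first by apply: subset_trans sRR' (subsetUr _ _).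
by rewrite cardsU1 R'r -in_setC xR'.
Qed.

Section Uncovering.
Variable T : finType.
Implicit Types (K : {set {perm T}}) (B : {set T}) (U : {set {set T}}).

(** A set that meets each of the pairwise disjoint bases contains a different
    point of every one of them, hence has more than [r] points. *)
Lemma is_ubb_disjoint K r U :
    (forall B, B \in U -> is_base K B) -> trivIset U -> r < #|U| ->
  is_ubb K r U.
Proof.
move=> baseU tiU ltrU; split=> // R cardR.
apply/exists_inP; apply: contraLR ltrU; rewrite negb_exists_in -leqNgt -cardR.
move/forall_inP => meetU.
have [U0 | [B0 UB0]] := set_0Vmem U; first by rewrite U0 cards0.
have [x0 _ _] : exists2 x, x \in R & x \in B0.
  move: (meetU _ UB0); rewrite disjoint_subset => /subsetPn[x Rx].
  by rewrite !inE negbK; exists x.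
pose h B := odflt x0 [pick x in R :&: B].
have hP B : B \in U -> h B \in R :&: B.
  move=> UB; rewrite /h; case: pickP => //= none.
  case/negP: (meetU _ UB); rewrite -setI_eq0.
  by apply/eqP/setP => x; rewrite none inE.
have /card_in_imset <- : {in U &, injective h}.
  move=> B C UB UC hBC; apply: contraTeq (hP B UB) => neBC.
  have /setIP[_ hC] := hP C UC; rewrite inE negb_and orbC hBC.
  by rewrite (disjointFl (trivIsetP tiU _ _ UB UC neBC) hC).
apply/subset_leq_card/subsetP => _ /imsetP[B UB ->].
by have /setIP[] := hP B UB.
Qed.

(** The empty set is not a base of a nontrivial [K].  If there were at most [r]
    bases, one point of each would give a set of at most [r] points that no
    base avoids. *)
Lemma ubb_card_gt K r U :
  K != 1%g -> r <= #|T| -> is_ubb K r U -> r < #|U|.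
Proof.
move=> K1 rT [baseU coverU]; rewrite ltnNge; apply/negP => leUr.
have neB B : B \in U -> B != set0.
  move=> /baseU; apply: contraTneq => ->; rewrite /is_base.
  have -> : ('C_K(set0 | 'P) = K)%g; last exact: K1.
  by apply/setP => s; rewrite !inE sub0set !andbT.
have [x0 | T0] := pickP T; last first.
  have [R _ cardR] : exists2 R : {set T}, set0 \subset R & #|R| = r.
    by apply: exists_superset_card; rewrite cards0.
  have [B UB _] := coverU _ cardR.
  by have /set0Pn[x] := neB B UB; have := T0 x.
move=> _; pose h B := odflt x0 [pick x in B].
have [|R sUR cardR] := @exists_superset_card _ (h @: U) r.
  by rewrite (leq_trans (leq_imset_card _ _) leUr).
have [B UB] := coverU _ cardR.
rewrite disjoint_sym disjoint_subset => /subsetP/(_ (h B)).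
have hB : h B \in B.
  by rewrite /h; case: pickP => //= B0; have /set0Pn[x] := neB B UB; rewrite B0.
by move=> /(_ hB) /negP[]; apply: (subsetP sUR); apply: imset_f.
Qed.

Lemma base_determines (K : {group {perm T}}) B s t :
    is_base K B -> s \in K -> t \in K -> (forall x, x \in B -> s x = t x) ->
  s = t.
Proof.
move=> /eqP K1 Ks Kt st; apply/eqP; rewrite eq_mulgV1 -in_set1 -[[set _]]K1.
rewrite !inE groupM ?groupV //=; apply/subsetP => x Bx; rewrite inE apermE.
by rewrite permM st ?permK.
Qed.

End Uncovering.

(** * Decoding twisted permutation codes *)

Section Twisted.
Variables (gT : finGroupType) (G : {group gT}) (T : finType) (lam : nat).
Variable rho : 'I_lam -> {morphism G >-> {perm T}}.

(** The positions where two words agree are the fixed points of the quotient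
    [g h^-1] in the various representations. *)
Lemma hamming_tw g h : g \in G -> h \in G ->
  hamming (tw_word rho g) (tw_word rho h) +
    \sum_(i < lam) #|[set x | rho i (g * h^-1)%g x == x]| = lam * #|T|.
Proof.
move=> Gg Gh.
have -> : \sum_(i < lam) #|[set x | rho i (g * h^-1)%g x == x]| =
    #|[set ix : 'I_lam * T | tw_word rho g ix == tw_word rho h ix]|.
  under eq_bigr do rewrite -sum1_card.
  rewrite -[RHS]sum1_card.
  rewrite pair_big_dep /=; apply: eq_bigl => -[i x] /=.
  rewrite !inE !ffunE morphM ?groupV // morphV //.
  by rewrite permM -(inj_eq (@perm_inj _ (rho i h))) permKV.
rewrite -[X in X * _]card_ord -card_prod addnC.
rewrite -(cardsC [set ix | tw_word rho g ix == tw_word rho h ix]).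
by congr (_ + _); apply: eq_card => ix; rewrite !inE.
Qed.

Lemma tw_component_few_errors g (w : {ffun 'I_lam * T -> T}) r :
    0 < lam -> hamming (tw_word rho g) w <= r ->
  exists i : 'I_lam, #|[set x | rho i g x != w (i, x)]| <= r %/ lam.
Proof.
move=> lam0 le_r; apply/existsP; apply: contraLR le_r.
rewrite negb_exists -ltnNge => /forallP many.
have -> : hamming (tw_word rho g) w =
    \sum_(i < lam) #|[set x | rho i g x != w (i, x)]|.
  under eq_bigr do rewrite -sum1_card.
  rewrite pair_big_dep /hamming -[LHS]sum1_card; apply: eq_bigl => -[i x] /=.
  by rewrite !inE ffunE.
apply: (@leq_trans (\sum_(i < lam) (r %/ lam).+1)).
  by rewrite sum_nat_const card_ord mulnC ltn_ceil.
by apply: leq_sum => i _; rewrite ltnNge.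
Qed.

(** Some component carries at most [r / lam] errors, and some base avoids them;
    a base without errors pins down the image of [g], hence [g].  A wrong guess
    made on the way does no harm: it is accepted only when its codeword lies
    within the correction capacity, and then it is the transmitted one. *)
Lemma ubb_decodes_twisted (K : {set {perm T}}) U :
    (forall i, ('injm (rho i))%g) -> (forall i, (rho i @* G)%g = K) ->
    0 < lam ->
    is_ubb K (corr_capacity (Tw rho) %/ lam) U ->
  ubb_decodes rho K (corr_capacity (Tw rho)) U.
Proof.
move=> injrho imrho lam0; set r := corr_capacity _ => -[baseU coverU] g w Gg gw.
have imK i h : h \in G -> rho i h \in K.
  by move=> Gh; rewrite -(imrho i) mem_morphim.
have det i B s t : B \in U -> s \in K -> t \in K ->
    agrees s w i B -> agrees t w i B -> s = t.
  move=> UB; rewrite -(imrho i) => Ks Kt /forall_inP sw /forall_inP tw.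
  have bB : is_base (rho i @* G)%g B by rewrite imrho; apply: baseU.
  apply: (base_determines bB Ks Kt) => x Bx.
  by rewrite (eqP (sw x Bx)) (eqP (tw x Bx)).
have [i few] := tw_component_few_errors lam0 gw.
have [|R sER cardR] :=
    @exists_superset_card _ [set x | rho i g x != w (i, x)] (r %/ lam).
  rewrite few -[X in _ <= X](mulKn _ lam0) leq_div2r //.
  rewrite -[X in X * _]card_ord -card_prod.
  apply: leq_trans (min_dist_le_length (Tw rho)).
  by rewrite /r /corr_capacity subn1 -divn2 (leq_trans (leq_div _ _)) ?leq_pred.
have [B UB disRB] := coverU R cardR.
have gwB : agrees (rho i g) w i B.
  apply/forall_inP => x Bx; apply/eqP; apply: contraTeq Bx => gwx.
  by rewrite (disjointFr disRB) // (subsetP sER) // inE.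
split.
  exists i, B => //; split=> // s Ks swB.
  by apply: det swB gwB => //; apply: imK.
move=> tries triesP.
have: (i, B) \in tries by rewrite triesP !inE.
have: {subset tries <= setX [set: 'I_lam] U} by move=> t; rewrite triesP.
elim: tries {triesP} => //= -[j C] tries IHt sub; rewrite inE.
have UC : C \in U by have := sub (j, C) (mem_head _ _); rewrite !inE.
have {}IHt : (i, B) \in tries -> decode rho r tries w = Some (tw_word rho g).
  by apply: IHt => t tr; apply: sub; rewrite inE tr orbT.
case: pickP => [h /andP[Gh hwC] | none].
  have [hw _ | far /predU1P[[ij BC] | //]] :=
      leqP (hamming (tw_word rho h) w) r.
    congr Some; apply: (@corr_capacity_unique _ _ (Tw rho) _ _ w) => //.
      exact: imset_f.
    exact: imset_f.
  rewrite -ij -BC in hwC.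
  have gh := det _ _ _ _ UB (imK i _ Gh) (imK i _ Gg) hwC gwB.
  by move: far; rewrite (injmP (injrho i) _ _ Gh Gg gh) ltnNge gw.
case/predU1P => [[ij BC] | //].
by have := none g; rewrite -ij -BC Gg gwB.
Qed.

End Twisted.

(** * Disjoint pairs of points from different classes *)

(** Sort [T] by the value of [f]: each fibre becomes a block of at most
    [p <= m] consecutive entries, so that the entries of index [i] and [i + m] have
    different values, and [i < m] gives the [m] pairs. *)
Lemma exists_pairing (T C : finType) (f : T -> C) p m :
    (forall c, #|[set x | f x == c]| <= p) -> p <= m -> m.*2 <= #|T| ->
  exists U : {set {set T}}, [/\ trivIset U, #|U| = m &
    forall B, B \in U -> exists x, exists2 y, f x != f y & B = [set x; y]].
Proof.
move=> small_fiber le_pm le_2mT; case: (posnP m) => [-> | m_gt0].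
  exists set0; split; first by apply/trivIsetP => A B; rewrite inE.
    exact: cards0.
  by move=> B; rewrite inE.
have [x0 _ | T0] := pickP T; last first.
  by move: le_2mT; rewrite leqNgt eq_card0 // double_gt0 m_gt0.
pose key x : nat := enum_rank (f x).
pose s := sort (relpre key leq) (enum T).
have size_s : size s = #|T| by rewrite size_sort cardE.
have uniq_s : uniq s by rewrite sort_uniq enum_uniq.
have sorted_s i j : i <= j < size s -> key (nth x0 s i) <= key (nth x0 s j).
  case/andP=> ij js.
  apply: (@sorted_leq_nth _ (relpre key leq)) => //.
  - by move=> a b c; apply: leq_trans.
  - by move=> a; apply: leqnn.
  - by apply: sort_sorted => a b; apply: leq_total.
  by rewrite inE (leq_ltn_trans ij).
have lt_2m i j : i < m -> j <= m -> i + j < size s.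
  move=> im jm; rewrite size_s (leq_trans _ le_2mT) // -addnn.
  by rewrite -addSn leq_add.
(* Equal values at both ends would make the m + 1 entries from i to i + m one
   fibre, since the sequence is sorted. *)
have far i : i < m -> f (nth x0 s i) != f (nth x0 s (i + m)).
  move=> im; apply/eqP => eq_f.
  have: #|[set x | f x == f (nth x0 s i)]| < m.+1.
    by rewrite ltnS (leq_trans _ le_pm).
  rewrite ltnNge => /negP[].
  have -> : m.+1 = size (take m.+1 (drop i s)).
    rewrite size_takel // size_drop ltn_subRL.
    by apply: lt_2m.
  rewrite cardE uniq_leq_size ?take_uniq ?drop_uniq // => x /(nthP x0)[j].
  rewrite size_takel; last by rewrite size_drop ltn_subRL lt_2m.
  move=> jm <-; rewrite nth_take // nth_drop mem_enum inE.
  apply/eqP/enum_rank_inj/val_inj/eqP; rewrite eqn_leq.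
  rewrite [X in X && _](_ : _ = true) ?[X in _ && X](_ : _ = true) //.
    by apply: sorted_s; rewrite leq_addr lt_2m.
  rewrite [in leqRHS]eq_f; apply: sorted_s.
  by rewrite leq_add2l lt_2m // andbT -ltnS.
pose pr (i : 'I_m) := [set nth x0 s i; nth x0 s (i + m)].
have nth_eq i j : i < size s -> j < size s ->
    (nth x0 s i == nth x0 s j) = (i == j).
  by move=> *; apply: nth_uniq.
have szi (i : 'I_m) : i < size s by rewrite -[X in X < _]addn0 lt_2m.
have szim (i : 'I_m) : i + m < size s by rewrite lt_2m.
have dis i j : i != j -> [disjoint pr i & pr j].
  move=> ij; rewrite -setI_eq0; apply/eqP/setP => x; rewrite !inE.
  apply/negP => /andP[xi xj].
  suff ij' : i = j :> nat by case/eqP: ij; apply: val_inj.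
  case/orP: xi xj => /eqP ->; rewrite !nth_eq // => /orP[] /eqP // E.
  - by have := ltn_ord i; rewrite E ltnNge leq_addl.
  - by have := ltn_ord j; rewrite -E ltnNge leq_addl.
  - exact: addIn E.
have inj_pr : injective pr.
  move=> i j eq_pr; apply/eqP; apply: contraT => /dis.
  rewrite eq_pr -setI_eq0 setIid => /eqP/setP/(_ (nth x0 s j)).
  by rewrite !inE eqxx.
exists [set pr i | i : 'I_m]; split.
- apply/trivIsetP => _ _ /imsetP[i _ ->] /imsetP[j _ ->] ne_pr.
  by apply: dis; apply: contraNneq ne_pr => ->.
- by rewrite card_imset // card_ord.
move=> _ /imsetP[i _ ->]; exists (nth x0 s i), (nth x0 s (i + m)) => //.
exact: far.
Qed.

(** * The matrix B and its nilpotent part *)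

Local Open Scope ring_scope.

Section Matrices.
Variables (p n : nat).
Hypotheses (p_pr : prime p) (lt_kp : (n.+2 < p)%N).
Local Notation k := n.+2.
Local Notation B := (Bmx p k).
Local Notation V := 'rV['F_p]_k.

(** On row vectors this is the shift
    [(u_0, ..., u_(k-1)) |-> (u_1, ..., u_(k-1), 0)]. *)
Definition Nmx : 'M['F_p]_k := B - 1.

(** The [i]-th power of [u |-> u B + w] is [u |-> u B^i + w Smx i]. *)
Definition Smx (i : nat) : 'M['F_p]_k := \sum_(l < i) B ^+ l.

Lemma mulmx_NmxE (u : V) j :
  (u *m Nmx) 0 j = if insub j.+1 is Some j' then u 0 j' else 0.
Proof.
have NE i : Nmx i j = (i == j.+1 :> nat)%:R.
  rewrite !mxE; have [-> | _] := eqVneq i j; last by rewrite subr0.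
  by rewrite subrr eqn_leq ltnn andbF.
rewrite mxE; under eq_bigr do rewrite NE mulr_natr.
case: insubP => [j' _ j'E | ].
  rewrite (bigD1 j') //= j'E eqxx mulr1n big1 ?addr0 // => i ij.
  by rewrite -j'E val_eqE (negPf ij).
rewrite -leqNgt => le_kj; rewrite big1 // => i _.
by rewrite ltn_eqF // (leq_trans (ltn_ord i)).
Qed.

Lemma natr_Fp_eq0 i : ((i%:R : 'F_p) == 0) = (p %| i)%N.
Proof. by rewrite (dvdn_pcharf (pchar_Fp p_pr)). Qed.

Lemma mulmx_Nmx_max (u : V) : (u *m Nmx) 0 ord_max = 0.
Proof. by rewrite mulmx_NmxE insubF //= ltnn. Qed.

Lemma mulmx_Bmx_max (u : V) i : (u *m B ^+ i) 0 ord_max = u 0 ord_max.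
Proof.
elim: i => [|i IHi]; first by rewrite expr0 mulmx1.
rewrite exprSr mulmxA -[X in _ *m X](subrK 1) mulmxDr mulmx1 mxE.
by rewrite mulmx_Nmx_max add0r.
Qed.

Lemma mulmx_Smx_max (u : V) i : (u *m Smx i) 0 ord_max = u 0 ord_max *+ i.
Proof.
rewrite mulmx_sumr summxE; under eq_bigr do rewrite mulmx_Bmx_max.
by rewrite sumr_const card_ord.
Qed.

Lemma mulmx_NmxX (u : V) l (j : 'I_k) :
  (k <= j + l)%N -> (u *m Nmx ^+ l) 0 j = 0.
Proof.
elim: l j => [|l IHl] j; first by rewrite addn0 leqNgt ltn_ord.
rewrite exprSr mulmxA mulmx_NmxE addnS -addSn.
by case: insubP => // j' _ <- /IHl.
Qed.

Lemma Nmx_nilpotent : Nmx ^+ k = 0.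
Proof.
apply/row_matrixP => i; rewrite rowE row0; apply/rowP => j.
by rewrite mulmx_NmxX ?leq_addl ?mxE.
Qed.

Lemma Bmx_expE i : B ^+ i = 1 + Nmx *m Smx i.
Proof. by apply/eqP; rewrite addrC -subr_eq subrX1. Qed.

(** This is the binomial expansion of [((1 + N)^i - 1) / N], cut off by
    [N^k = 0]. *)
Lemma SmxE i : Smx i = \sum_(l < k) Nmx ^+ l *+ 'C(i, l.+1).
Proof.
elim: i => [|i IHi].
  by rewrite /Smx big_ord0 big1 // => l _; rewrite bin0n mulr0n.
rewrite /Smx big_ord_recr /= -/(Smx i) Bmx_expE {2}IHi mulmx_sumr.
under [RHS]eq_bigr do rewrite binS mulrnDr.
rewrite big_split IHi /=; congr (_ + _).
rewrite big_ord_recr [RHS]big_ord_recl /= expr0 bin0 mulr1n; congr (_ + _).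
rewrite [X in _ + X](_ : _ = 0) ?addr0.
  by apply: eq_bigr => l _; rewrite exprS -mulrnAr.
by rewrite -[_ *m _]/(_ * _) mulrnAr -exprS Nmx_nilpotent mul0rn.
Qed.

(** The binomial coefficients ['C(p, l.+1)] in [SmxE] have [l.+1 <= k < p],
    hence are divisible by [p]. *)
Lemma Smx_p : Smx p = 0.
Proof.
rewrite SmxE big1 // => l _; rewrite -scaler_nat.
have /eqP -> : ('C(p, l.+1)%:R : 'F_p) == 0; last by rewrite scale0r.
by rewrite natr_Fp_eq0 prime_dvd_bin // (leq_ltn_trans _ lt_kp).
Qed.

Lemma Bmx_exp_p : B ^+ p = 1.
Proof. by rewrite Bmx_expE Smx_p mulmx0 addr0. Qed.

(** The shift forgets the first coordinate only, so that coordinate separates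
    the points of a fibre. *)
Lemma Nmx_fiber_card (c : V) : (#|[set u | u *m Nmx == c]| <= p)%N.
Proof.
rewrite -[leqRHS](card_Fp p_pr).
rewrite -(@card_in_imset _ _ (fun u : V => u 0 0)) ?max_card //.
move=> u v; rewrite !inE => /eqP<- /eqP uv uv0.
apply/rowP => i; case: (unliftP ord0 i) => [j ->|->] //.
move/rowP/(_ (widen_ord (leqnSn _) j)): uv; rewrite !mulmx_NmxE.
case: insubP => [j' _ /= j'E | /negP[]]; last exact: ltn_ord j.
by have -> : lift ord0 j = j' by apply: val_inj.
Qed.

(** As [B^p = 1], the matrix [B] is a power of [B^i], so it fixes what [B^i]
    fixes. *)
Lemma Bmx_exp_fix (u : V) i : ~~ (p %| i)%N -> u *m B ^+ i = u -> u *m Nmx = 0.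
Proof.
move=> pi uBi.
have i_gt0 : (0 < i)%N by case: i pi {uBi} => //; rewrite dvdn0.
have /coprimeP[// | [a b] /= ab] : coprime i p.
  by rewrite coprime_sym prime_coprime.
have {}ab : (i * a = 1 + p * b)%N.
  rewrite mulnC (mulnC p) -(subnK (_ : b * p <= a * i)%N) ?ab //.
  by rewrite ltnW // -subn_gt0 ab.
have uBia : u *m B ^+ (i * a) = u.
  elim: a {ab} => [|a IHa]; first by rewrite muln0 expr0 mulmx1.
  by rewrite mulnS exprD mulmxA uBi.
rewrite mulmxBr mulmx1 -{2}uBia ab exprD exprM Bmx_exp_p expr1n mulr1 expr1.
exact: subrr.
Qed.

End Matrices.

(** * From affine maps to permutations of Omega *)

Section Relabel.
Variables (p k : nat).
Local Notation V := 'rV['F_p]_k.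

Lemma omega_subproof (v : V) : lsubmx (row_mx 1%:M v : 'rV_(1 + k)) == 1%:M.
Proof. by rewrite row_mxKl. Qed.

Definition omega (v : V) : Omega p k := MkOmega (omega_subproof v).
Definition tail (w : Omega p k) : V := rsubmx (val w).

Lemma omegaK : cancel omega tail.
Proof. by move=> v; rewrite /tail row_mxKr. Qed.

Lemma tailK : cancel tail omega.
Proof.
by move=> w; apply: val_inj; rewrite /= -(eqP (valP w)) hsubmxK.
Qed.

Definition relabel (s : {perm V}) : {perm Omega p k} :=
  perm (inj_comp (can_inj omegaK) (inj_comp (@perm_inj _ s) (can_inj tailK))).

Lemma relabelE s w : relabel s w = omega (s (tail w)).
Proof. by rewrite permE. Qed.

Lemma relabelM : {morph relabel : s t / (s * t)%g}.
Proof.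
by move=> s t; apply/permP=> w; rewrite permM !relabelE omegaK permM.
Qed.

Lemma relabel_inj : injective relabel.
Proof.
move=> s t /permP st; apply/permP => v; have := st (omega v).
by rewrite !relabelE omegaK => /(can_inj omegaK).
Qed.

Lemma relabel_fix s w : (relabel s w == w) = (s (tail w) == tail w).
Proof. by rewrite relabelE (can2_eq omegaK tailK). Qed.

Lemma card_tail (P : pred V) : #|[set w | P (tail w)]| = #|[set v | P v]|.
Proof.
rewrite -(card_imset _ (can_inj omegaK)); apply: eq_card => w.
by rewrite inE -[w in RHS]tailK (mem_imset _ _ (can_inj omegaK)) inE.
Qed.

Lemma card_Omega : prime p -> #|{: Omega p k}| = (p ^ k)%N.
Proof.
move=> p_pr; rewrite -cardsT.
by rewrite (card_tail xpredT) cardsT card_mx mul1n card_Fp.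
Qed.

End Relabel.

Arguments omega {p k} v.
Arguments tail {p k} w.
Arguments relabel {p k} s.

(** * Twisting the group by automorphisms *)

Section Twist.
Variables (p n : nat).
Hypotheses (p_pr : prime p) (lt_kp : (n.+2 < p)%N).
Local Notation k := n.+2.
Local Notation B := (Bmx p k).
Local Notation V := 'rV['F_p]_k.
Local Notation N := (Nmx p n).
Implicit Types (a u v w : V) (i : nat).

Definition shear w : {perm V} := (Bperm p k * transl w)%g.

Lemma shear0 : shear 0 = Bperm p k.
Proof. by apply/permP => u; rewrite permM [LHS]permE addr0. Qed.

Lemma shearXE w i u : (shear w ^+ i)%g u = u *m B ^+ i + w *m Smx p n i.
Proof.
elim: i u => [|i IHi] u.
  by rewrite expg0 perm1 expr0 mulmx1 /Smx big_ord0 mulmx0 addr0.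
rewrite expgS permM IHi /shear permM ![transl _ _]permE [Bperm _ _ _]permE.
rewrite mulmxDl -mulmxA -[B *m _]exprS /Smx big_ord_recr mulmxDr.
by rewrite addrA addrAC.
Qed.

Lemma shearX_dvd w i : (p %| i)%N -> (shear w ^+ i = 1)%g.
Proof.
case/dvdnP => q ->; rewrite mulnC expgM.
rewrite [X in (X ^+ _)%g](_ : _ = 1%g) ?expg1n //.
apply/permP => u.
by rewrite shearXE Bmx_exp_p // Smx_p // mulmx1 mulmx0 addr0 perm1.
Qed.

Lemma order_shear_dvd w : (#[shear w]%g %| p)%N.
Proof. by rewrite order_dvdn shearX_dvd. Qed.

Lemma Nmx_neq0 : exists u, u *m N != 0.
Proof.
exists (delta_mx 0 (lift ord0 ord0)); apply/eqP => /rowP/(_ 0).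
rewrite mulmx_NmxE; case: insubP => // j _ jE.
have -> : j = lift ord0 ord0 by apply: val_inj.
by rewrite !mxE !eqxx => /eqP; rewrite oner_eq0.
Qed.

Lemma order_Bperm : #[Bperm p k]%g = p.
Proof.
apply: nt_prime_order => //; first by rewrite -shear0 shearX_dvd.
have [u uN] := Nmx_neq0; apply: contraNneq uN => B1.
rewrite mulmxBr mulmx1 subr_eq0; apply/eqP.
by move/permP/(_ u): B1; rewrite perm1 permE.
Qed.

Lemma order_shear_dvd_Bperm w : (#[shear w]%g %| #[Bperm p k]%g)%N.
Proof. by rewrite order_Bperm order_shear_dvd. Qed.

Lemma GkP s :
  reflect (exists a i, s = (transl a * Bperm p k ^+ i)%g) (s \in Gk p k).
Proof.
have [_ <- _ _] := sdprodP (Gk_sdprod p k).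
apply: (iffP mulsgP) => [[_ _ /imsetP[a _ ->] /cycleP[i ->] ->] | [a [i ->]]].
  by exists a, i.
by exists (transl a) (Bperm p k ^+ i)%g; rewrite ?imset_f ?mem_cycle.
Qed.

Lemma transl_Gk a : transl a \in Gk p k.
Proof. by apply/GkP; exists a, 0; rewrite expg0 mulg1. Qed.

Lemma Bperm_Gk : Bperm p k \in Gk p k.
Proof.
apply/GkP; exists 0, 1%N; apply/permP => u.
by rewrite permM [transl _ _]permE addr0.
Qed.

Lemma shear_Gk w : shear w \in Gk p k.
Proof. by rewrite groupM ?transl_Gk ?Bperm_Gk. Qed.

Lemma card_Gk : #|Gk p k| = (p ^ k.+1)%N.
Proof.
rewrite -(sdprod_card (Gk_sdprod p k)) /= -orderE order_Bperm.
rewrite card_imset; first by rewrite card_mx mul1n card_Fp // -expnSr.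
by move=> a b /permP/(_ 0); rewrite !permE !add0r.
Qed.

(** The right-hand side does not depend on [w], since translations commute.
    That is why fixing the translations and sending [B] to [shear w] is
    compatible with the action of [B]. *)
Lemma transl_conj_shear a w i :
  (transl a ^ (shear w ^+ i) = transl (a *m B ^+ i))%g.
Proof.
apply/permP => u; rewrite conjgE !permM -[u in RHS](permKV (shear w ^+ i)%g).
by rewrite !shearXE ![transl _ _]permE mulmxDl addrAC.
Qed.

Lemma twist_compat w :
  {in translations p k & Hk p k,
    morph_act 'J 'J (idm [group of translations p k])
                    (eltm (order_shear_dvd_Bperm w))}.
Proof.
move=> _ _ /imsetP[a _ ->] /cycleP[i ->] /=; rewrite eltmE /idm.
by rewrite transl_conj_shear -shear0 transl_conj_shear.
Qed.

(** An automorphism of [Gk p k], with values taken as permutations so that they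
    can be relabelled.  It is well defined because [Smx p = 0] makes the order of
    [shear w] divide that of [Bperm p k]. *)
Definition twist w : {morphism Gk p k >-> {perm V}} :=
  sdprodm_morphism (Gk_sdprod p k) (twist_compat w).

Lemma twistE w a i :
  twist w (transl a * Bperm p k ^+ i)%g = (transl a * shear w ^+ i)%g.
Proof.
by rewrite /= sdprodmE ?imset_f ?mem_cycle // /= eltmE.
Qed.

Lemma twist_Bperm w : twist w (Bperm p k) = shear w.
Proof.
have t0 : transl (0 : V) = 1%g by apply/permP => u; rewrite permE addr0 perm1.
by have := twistE w 0 1; rewrite t0 !mul1g.
Qed.

Lemma twist_Gk w s : s \in Gk p k -> twist w s \in Gk p k.
Proof.
by case/GkP => a [i ->]; rewrite twistE groupM ?groupX ?transl_Gk ?shear_Gk.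
Qed.

(** The difference of two fixed points of [x |-> x B^i + c] is fixed by [B^i],
    hence lies in the kernel of [N] unless [p] divides [i]. *)
Lemma transl_shear_fix_dvd a w i u v :
    (transl a * shear w ^+ i)%g u = u -> (transl a * shear w ^+ i)%g v = v ->
    u *m N != v *m N ->
  (p %| i)%N.
Proof.
rewrite !permM !shearXE ![transl _ _]permE => fu fv.
apply: contraR => pi; rewrite -subr_eq0 -mulmxBl; apply/eqP.
apply: (Bmx_exp_fix p_pr lt_kp pi).
rewrite -[in RHS]fu -[in RHS]fv opprD addrACA subrr addr0 -mulmxBl.
by rewrite opprD addrACA subrr addr0.
Qed.

Lemma transl_eq1 a u : transl a u = u -> transl a = 1%g.
Proof.
rewrite permE => /(congr1 (+%R (- u))); rewrite addKr addNr => ->.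
by apply/permP => v; rewrite permE addr0 perm1.
Qed.

(** An element that becomes the identity fixes vectors of different classes
    after the twist, so its linear part is trivial, and [twist w] does not
    change translations. *)
Lemma twist_injm w : ('injm (twist w))%g.
Proof.
apply/injmP => s t Gs Gt eq_st.
apply/eqP; rewrite eq_mulgV1; set z := (s * t^-1)%g.
have: twist w z = 1%g by rewrite morphM ?groupV // morphV // eq_st mulgV.
have /GkP[a [i ->]] : z \in Gk p k by rewrite groupM ?groupV.
rewrite twistE => z1; have [u uN] := Nmx_neq0.
have pi : (p %| i)%N.
  by apply: (@transl_shear_fix_dvd a w i u 0); rewrite ?z1 ?perm1 // mul0mx.
move: z1; rewrite shearX_dvd // -shear0 shearX_dvd // !mulg1 => ta.
by rewrite ta.
Qed.

(** The linear part is trivial by [transl_shear_fix_dvd], and a translation with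
    a fixed point is the identity. *)
Lemma Gk_fix_classes s u v :
  s \in Gk p k -> s u = u -> s v = v -> u *m N != v *m N -> s = 1%g.
Proof.
case/GkP => a [i ->]; rewrite -shear0 => fu fv uv.
have pi := transl_shear_fix_dvd fu fv uv.
move: fu; rewrite shearX_dvd // mulg1; exact: transl_eq1.
Qed.

Lemma Gk_card_fix s :
  s \in Gk p k -> s != 1%g -> (#|[set u | s u == u]| <= p)%N.
Proof.
move=> Gs s1; have [-> | [u]] := set_0Vmem [set u | s u == u].
  by rewrite cards0.
rewrite inE => /eqP su.
apply: leq_trans (Nmx_fiber_card p_pr (u *m N)); apply: subset_leq_card.
apply/subsetP => v; rewrite !inE => /eqP sv.
by apply: contraNT s1 => uv; apply/eqP; apply: (Gk_fix_classes Gs sv su).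
Qed.

(** For [i] prime to [p], the image of [B^i - 1] is the space of vectors with last
    coordinate 0, so these vectors represent the translation parts modulo those
    that allow a fixed point. *)
Definition last_vec (c : 'F_p) : V := c *: delta_mx 0 ord_max.

(** [B] preserves the last coordinate, so comparing last coordinates in
    [u B^i + a B^i + (last_vec c) Smx i = u] gives [a_(k-1) + i c = 0].  For
    [i] prime to [p] this determines [c]; for [i] divisible by [p] the element
    is a translation, which has no fixed point. *)
Lemma twist_fix_unique s (c d : 'F_p) u v : s \in Gk p k -> s != 1%g ->
  twist (last_vec c) s u = u -> twist (last_vec d) s v = v -> c = d.
Proof.
case/GkP=> a [i ->] s1; rewrite !twistE => fu fv.
have pi : ~~ (p %| i)%N.
  apply: contra s1 => pi; move: fu.
  rewrite shearX_dvd // mulg1 => /transl_eq1 ->.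
  by rewrite -shear0 shearX_dvd // mulg1.
have lastE (c' : 'F_p) w : (transl a * shear (last_vec c') ^+ i)%g w = w ->
    a 0 ord_max + c' *+ i = 0.
  rewrite permM shearXE [transl _ _]permE => /rowP/(_ ord_max).
  rewrite mxE mulmx_Bmx_max mulmx_Smx_max !mxE !eqxx mulr1 -addrA.
  by move/(congr1 (+%R (- w 0 ord_max))); rewrite addKr addNr.
have := lastE _ _ fu; rewrite -(lastE _ _ fv) => /addrI /eqP.
rewrite -subr_eq0 -mulrnBl -mulr_natr mulf_eq0 natr_Fp_eq0 // (negPf pi) orbF.
by rewrite subr_eq0 => /eqP.
Qed.

Definition twist_index (j : 'I_p) := last_vec (j : nat)%:R.

Lemma sum_twist_fix_le s : s \in Gk p k -> s != 1%g ->
  (\sum_(j < p) #|[set u | twist (twist_index j) s u == u]| <= p)%N.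
Proof.
move=> Gs s1.
have tw1 w : twist w s != 1%g.
  apply: contra s1 => /eqP tws; apply/eqP/(injmP (twist_injm w)) => //.
  by rewrite morph1.
pose fixes (j : 'I_p) := [set u | twist (twist_index j) s u == u].
have [j0 j0fix | none] := pickP [pred j | fixes j != set0].
  rewrite (bigD1 j0) //= big1 ?addn0.
    exact: Gk_card_fix (twist_Gk _ Gs) (tw1 _).
  move=> j; apply: contraNeq; rewrite cards_eq0 => /set0Pn[v].
  case/set0Pn: j0fix => u; rewrite !inE => /eqP fu /eqP fv.
  have /(congr1 val) := twist_fix_unique Gs s1 fv fu.
  by rewrite /= !val_Fp_nat // !modn_small // => /val_inj ->.
rewrite big1 // => j _; apply/eqP; rewrite cards_eq0.
by have /negbFE := none j.
Qed.

(** The fixed points include the line spanned by the first basis vector; this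
    makes the bound of [sum_twist_fix_le] sharp. *)
Lemma Bperm_card_fix : (p <= #|[set u : V | Bperm p k u == u]|)%N.
Proof.
rewrite -[leqLHS](card_Fp p_pr).
have inj : injective (fun c : 'F_p => c *: delta_mx 0 0 : V).
  by move=> c d /rowP/(_ 0); rewrite !mxE !eqxx !mulr1.
rewrite -cardsT -(card_imset _ inj); apply/subset_leq_card/subsetP.
move=> _ /imsetP[c _ ->]; rewrite inE permE.
rewrite -subr_eq0 -{2}[_ *: _]mulmx1 -mulmxBr.
apply/eqP/rowP => j; rewrite mulmx_NmxE mxE; case: insubP => // j' _ j'E.
have /negPf j'0 : j' != 0 by rewrite -val_eqE /= j'E.
by rewrite !mxE j'0 andbF mulr0.
Qed.

Lemma relabel_twistM w :
  {in Gk p k &, {morph relabel \o twist w : s t / (s * t)%g}}.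
Proof. by move=> s t Gs Gt; rewrite /= -relabelM -morphM. Qed.

Definition twisted_rep w := Morphism (relabel_twistM w).

Lemma twisted_rep_injm w : ('injm (twisted_rep w))%g.
Proof.
by apply/injmP => s t Gs Gt /relabel_inj; apply: (injmP (twist_injm w)).
Qed.

Lemma Gbar_relabel : Gbar p k = [set relabel s | s in Gk p k].
Proof.
have AmxE (u v : V) i :
    (row_mx 1%:M u : 'rV_(1 + k)) *m Amx v i = row_mx 1%:M (u *m B ^+ i + v).
  by rewrite mul_row_block !mul1mx mulmx0 addr0 addrC.
apply/setP => s; rewrite inE; apply/exists_inP/imsetP.
  case=> _ /imset2P[v i _ _ ->] /forallP sE.
  exists (Bperm p k ^+ i * transl v)%g.
    by rewrite groupM ?groupX ?Bperm_Gk ?transl_Gk.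
  apply/permP => w; apply: val_inj; rewrite relabelE (eqP (sE w)) /=.
  rewrite -[in LHS](tailK w) AmxE permM [transl _ _]permE.
  by rewrite -shear0 shearXE mul0mx addr0.
case=> t /GkP[a [i ->]] ->.
exists (Amx (a *m B ^+ i) (i %% p)).
  apply/imset2P.
  by exists (a *m B ^+ i) (Ordinal (ltn_pmod i (prime_gt0 p_pr))).
apply/forallP => w; rewrite -[in X in _ == X](tailK w) AmxE relabelE /=.
rewrite permM -shear0 shearXE mul0mx addr0 [transl _ _]permE mulmxDl.
suff -> : B ^+ (i %% p) = B ^+ i by [].
by rewrite [in RHS](divn_eq i p) exprD mulnC exprM Bmx_exp_p // expr1n mul1r.
Qed.

Lemma twisted_rep_im w : (twisted_rep w @* Gk p k)%g = Gbar p k.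
Proof.
rewrite Gbar_relabel; apply/eqP; rewrite eqEcard; apply/andP; split.
  apply/subsetP => _ /morphimP[s _ Gs ->] /=; apply: imset_f; exact: twist_Gk.
by rewrite card_injm ?twisted_rep_injm // leq_imset_card.
Qed.

End Twist.

Local Close Scope ring_scope.

(** * Bases of size two and the theorem *)

Lemma Gbar_is_base p n (x y : Omega p n.+2) : prime p -> n.+2 < p ->
    (tail x *m Nmx p n != tail y *m Nmx p n)%R ->
  is_base (Gbar p n.+2) [set x; y].
Proof.
move=> p_pr lt_kp xy; rewrite /is_base eqEsubset; apply/andP; split; last first.
  rewrite sub1set inE group1 andbT -(twisted_rep_im p_pr lt_kp 0) group1 //.
apply/subsetP => s /setIP[]; rewrite Gbar_relabel // => /imsetP[t Gt ->].
move/astabP => fix_s; rewrite inE.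
have tfix w : w \in [set x; y] -> t (tail w) = tail w.
  by move=> wB; apply/eqP; rewrite -relabel_fix; apply/eqP/fix_s.
have -> : t = 1%g.
  by apply: Gk_fix_classes (tfix x _) (tfix y _) xy; rewrite ?inE ?eqxx ?orbT.
apply/eqP/permP => w; rewrite relabelE !perm1; exact: tailK.
Qed.

Theorem theorem3p7 (p k : nat) (p_prime : prime p) (k_bounds : 1 < k < p) :
  exists rho : 'I_p -> {morphism Gk p k >-> {perm Omega p k}},
    (forall i : 'I_p, ('injm (rho i))%g /\ (rho i @* Gk p k)%g = Gbar p k) /\
    #|Tw rho| = p ^ k.+1 /\
    code_length (Tw rho) = p ^ k.+1 /\
    min_dist (Tw rho) = p ^ k.+1 - p /\
    let r_tw := corr_capacity (Tw rho) in
    let r' := r_tw %/ p in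
    r' + 1 = (p ^ k - 1) %/ 2 /\
    exists U : {set {set Omega p k}},
      is_optimal_ubb (Gbar p k) r' U /\
      #|U| = r' + 1 /\
      ubb_decodes rho (Gbar p k) r_tw U.
Proof.
case: k k_bounds => [|[|n]] // /andP[_ lt_kp].
have p_gt0 := prime_gt0 p_prime.
have p_gt2 : 2 < p by apply: leq_trans lt_kp.
have lt_pN : p * 2 < p ^ n.+2.
  rewrite expnS ltn_pmul2l // (leq_trans p_gt2) // -[leqLHS]expn1.
  by rewrite leq_exp2l // prime_gt1.
have odd_N : odd (p ^ n.+2).
  by rewrite oddX; case/even_prime: p_prime p_gt2 => [-> // | ->]; rewrite orbT.
have cardO := card_Omega n.+2 p_prime.
set m := (p ^ n.+2)./2.
have NE : p ^ n.+2 = m.*2.+1 by rewrite -[LHS]odd_double_half odd_N.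
have le_pm : p <= m by move: lt_pN; rewrite NE muln2 ltnS leq_double.
have m_gt0 : 0 < m := leq_trans p_gt0 le_pm.
have distE : p ^ n.+3 - p = (p * m).*2.
  by rewrite expnS NE mulnS addKn -doubleMr.
pose rho (j : 'I_p) := twisted_rep p_prime lt_kp (twist_index n j).
have injrho j : ('injm (rho j))%g by apply: twisted_rep_injm.
have imrho j : (rho j @* Gk p n.+2)%g = Gbar p n.+2 by apply: twisted_rep_im.
have agreeE s : \sum_(j < p) #|[set w | rho j s w == w]| =
    \sum_(j < p) #|[set u | twist p_prime lt_kp (twist_index n j) s u == u]|.
  apply: eq_bigr => j _; rewrite -card_tail; apply: eq_card => w.
  by rewrite !inE relabel_fix.
(* The codewords of g and h agree in at most p positions, by the bound on the
   fixed points of g h^-1. *)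
have ham g h : g \in Gk p n.+2 -> h \in Gk p n.+2 -> g != h ->
    (p * m).*2 <= hamming (tw_word rho g) (tw_word rho h).
  move=> Gg Gh gh; rewrite -distE leq_subLR expnS -cardO.
  rewrite -(hamming_tw rho Gg Gh) addnC leq_add2r agreeE sum_twist_fix_le //.
    by rewrite groupM ?groupV.
  by rewrite -eq_mulgV1.
have inj_tw : {in Gk p n.+2 &, injective (tw_word rho)}.
  move=> g h Gg Gh eq_gh; apply/eqP/contraT => /(ham g h Gg Gh).
  rewrite eq_gh /hamming eq_card0 ?leqn0 ?double_eq0 ?muln_eq0.
    by rewrite (gtn_eqF p_gt0) (gtn_eqF m_gt0).
  by move=> x; rewrite !inE eqxx.
have cardTw : #|Tw rho| = p ^ n.+3 by rewrite card_in_imset // card_Gk.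
have lenTw : code_length (Tw rho) = p ^ n.+3.
  by rewrite /code_length card_prod card_ord cardO -expnS.
have distTw : min_dist (Tw rho) = p ^ n.+3 - p.
  apply/eqP; rewrite eqn_leq; apply/andP; split; last first.
    apply: le_min_dist.
      by rewrite -[X in _ <= X]/(code_length (Tw rho)) lenTw leq_subr.
    move=> _ _ /imsetP[g Gg ->] /imsetP[h Gh ->] gh; rewrite distE.
    by apply: ham => //; apply: contraNneq gh => ->.
  (* The bound is attained by B and the identity: the untwisted representation,
     of index 0, gives B its p fixed points. *)
  have GB := Bperm_Gk p n.
  have B1 : Bperm p n.+2 != 1%g.
    by rewrite -order_eq1 order_Bperm // gtn_eqF // prime_gt1.
  pose B := Bperm p n.+2.
  apply: leq_trans (_ : hamming (tw_word rho B) (tw_word rho 1%g) <= _).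
    apply: min_dist_le_hamming; rewrite ?imset_f //.
    by apply: contraNneq B1 => /inj_tw; rewrite /B => ->.
  rewrite leq_subRL; last by rewrite expnS leq_pmulr // expn_gt0 p_gt0.
  rewrite expnS -cardO -(hamming_tw rho GB (group1 _)) addnC leq_add2l.
  rewrite invg1 mulg1 agreeE (bigD1 (Ordinal p_gt0)) //=.
  apply: leq_trans (leq_addr _ _).
  have -> : twist_index n (Ordinal p_gt0) = 0%R.
    by rewrite /twist_index /last_vec /= scale0r.
  by rewrite twist_Bperm shear0 Bperm_card_fix.
have r'E : corr_capacity (Tw rho) %/ p = m.-1.
  rewrite /corr_capacity distTw distE subn1.
  have -> : (p * m).*2.-1./2 = (p * m).-1.
    rewrite -[in LHS](prednK (_ : 0 < p * m)) ?muln_gt0 ?p_gt0 //=.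
    exact: uphalf_double.
  have -> : (p * m).-1 = m.-1 * p + p.-1.
    by rewrite -{1}(prednK m_gt0) mulnS addnC mulnC -(subn1 p) addnBA // subn1.
  by rewrite divnMDl // divn_small ?addn0 // prednK.
exists rho; do 4![split=> //]; rewrite /= r'E addn1 prednK //; split.
  by rewrite NE subn1 /= divn2 doubleK.
have [|||U [tiU cardU pairU]] :=
    @exists_pairing (Omega p n.+2) _ (fun w => (tail w *m Nmx p n)%R) p m.
- move=> c; rewrite (card_tail (fun u => u *m Nmx p n == c)%R).
  exact: Nmx_fiber_card.
- exact: le_pm.
- by rewrite cardO NE.
have baseU B : B \in U -> is_base (Gbar p n.+2) B.
  by case/pairU => x [y xy ->]; apply: Gbar_is_base.
have ubbU : is_ubb (Gbar p n.+2) m.-1 U.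
  by apply: is_ubb_disjoint; rewrite ?cardU ?prednK.
exists U; split; last split=> //.
  split=> // U' ubbU'; rewrite cardU -(prednK m_gt0).
  apply: ubb_card_gt ubbU'; last first.
    by rewrite cardO NE (leq_trans (leq_pred _)) // -addnn -addnS leq_addr.
  rewrite -(imrho (Ordinal p_gt0)) -cardG_gt1 card_injm // card_Gk //.
  by rewrite -[X in X < _](expn0 p) ltn_exp2l // prime_gt1.
by apply: ubb_decodes_twisted => //; rewrite r'E.
Qed.
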